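(* Let $e\ge2$ be an integer. Let $(a,b)$ be a pair of positive integers and let $(\delta_a,\delta_b)\in(\mathbb{N}\setminus\{1\})^2$ be such that $a+\delta_a\le q-1$, $b+\delta_b\le q-1$, $b-ea\ge0$ and $\delta_b-e\delta_a\in\{0,1,\dots,q-1\}\setminus\{1\}$. Then there exists a $[[n,k,d]]_q$ CSS quantum code, where $$n=(q+1)^2,$$ $$k=(a+\delta_a+1)\left(b+\delta_b+1-\frac{e(a+\delta_a)}{2}\right)-(a+1)\left(b+1-\frac{ea}{2}\right),$$ $$d\ge\min\{a,\,b-ea\}+2 .$$
   Context: $q$ is a prime power and $\mathbb{F}_q$ the field with $q$ elements; $\mathbb{N}=\{0,1,2,\dots\}$. For $E\subset\mathbb{F}_q^n\setminus\{0\}$, $d(E)$ denotes the minimal Hamming weight of an element of $E$ (with the convention $d(\emptyset)=+\infty$), and duals are taken with respect to the standard (Euclidean) bilinear form. A $[[n,k,d]]_q$ CSS quantum code is the quantum code $(C_1,C_2)_{\mathrm{CSS}}$ associated with a pair of linear codes $C_1\subset C_2\subset\mathbb{F}_q^n$; its parameters are $k=\dim C_2-\dim C_1$ and $d=\min\{d(C_2\setminus C_1),\,d(C_1^\perp\setminus C_2^\perp)\}$. *)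

(* Defs.v *)
From mathcomp Require Import all_boot all_order all_algebra.
From mathcomp Require Import constructive_ereal.

Set Implicit Arguments.
Unset Strict Implicit.
Unset Printing Implicit Defensive.

Import Order.TTheory GRing.Theory Num.Theory.
Local Open Scope ring_scope.

Definition hamming_weight (F : finFieldType) (n : nat) (x : 'rV[F]_n) : nat :=
  #|[set i : 'I_n | x 0 i != 0]|.

(* Valued in [\bar int] so that the minimum over the empty set is [+oo]. *)
Definition min_weight (F : finFieldType) (n : nat) (E : {set 'rV[F]_n}) :
    \bar int :=
  \big[Order.min/+oo%E]_(x in E) ((hamming_weight x)%:Z)%:E.

Definition dual_code (F : finFieldType) (n : nat) (C : {vspace 'rV[F]_n}) :
    {set 'rV[F]_n} :=
  [set x : 'rV[F]_n | [forall (c | c \in C), \sum_(i < n) x 0 i * c 0 i == 0]].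

(* A CSS code is represented by its defining pair of nested classical codes;
   its parameters are functions of that pair. *)
Record css_code (F : finFieldType) (n : nat) := CSSCode {
  css_inner : {vspace 'rV[F]_n};
  css_outer : {vspace 'rV[F]_n};
  css_nested : (css_inner <= css_outer)%VS
}.

(* The truncated subtraction is exact, by [css_nested]. *)
Definition css_dim (F : finFieldType) (n : nat) (Q : css_code F n) : nat :=
  (\dim (css_outer Q) - \dim (css_inner Q))%N.

Definition css_dist (F : finFieldType) (n : nat) (Q : css_code F n) :
    \bar int :=
  Order.min
    (min_weight [set x in css_outer Q | x \notin css_inner Q])
    (min_weight (dual_code (css_inner Q) :\: dual_code (css_outer Q))).

(* Main.v *)
(* Sections of bidegree (A, B) on the Hirzebruch surface H_e are evaluated at its
   (q + 1)^2 rational points.  For e A <= B they are spanned by the monomials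
   T0^(B-ej-i) T1^i X0^(A-j) X1^j with j <= A and i + ej <= B.

   Evaluation codes of different degrees are not nested.  But the section space
   of degree (da, db) contains some g without rational zeros, so multiplication
   by g sends the code of degree (a, b) isometrically into the code of degree
   (a + da, b + db).  Such a g is built from binary forms without rational
   zeros, which exist in every degree d <> 1: x^d - x^(d-1) is not injective on
   F_q, hence misses a value c, and v^d - v^(d-1) u - c u^d vanishes only at
   u = v = 0.  With L and N such forms in T, of degrees db - e da and e, and G
   one of degree da, take g = L G(X0 N, X1).

   A nonzero section of degree (A, B) is nonzero on at least q + 1 - B fibres of
   H_e over P^1, with at least q + 1 - A nonzero values on each of them.  This
   gives the dimensions and the distance of the large code.  The dual distance
   of the small code follows by separating one point from min(a, b - ea) others
   with a product of sections, each of degree (0, 1) or (1, e). *)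

Require Import Defs.
From mathcomp Require Import all_boot all_order all_algebra.
From mathcomp Require Import constructive_ereal.
From mathcomp Require Import zify ring.
Import Order.TTheory GRing.Theory Num.Theory.
Local Open Scope ring_scope.

(** * Binary forms on the projective line *)

Section FiniteField.

Set Implicit Arguments.
Unset Strict Implicit.

Variable F : finFieldType.

Lemma exists_missed_value (d : nat) : (2 <= d)%N ->
  exists c : F, forall x : F, x ^+ d - x ^+ d.-1 - c != 0.
Proof.
case: d => [|[|d]] // _; set f := fun x : F => x ^+ d.+2 - x ^+ d.+1.
have [/forallP fsurj|] := boolP [forall c, c \in codom f].
  have: {in F &, injective f}.
    apply/image_injP/eqP/eq_card => c; rewrite [in RHS]inE; exact: fsurj.
  move/(_ 0 1 isT isT); rewrite /f !expr0n !expr1n /= !subrr => /(_ erefl)/eqP.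
  by rewrite eq_sym oner_eq0.
rewrite negb_forall => /existsP[c Nc]; exists c => x.
by rewrite subr_eq0; apply: contraNneq Nc => <-; apply: codom_f.
Qed.

(* A point of P^1 is [Some t] for (1 : t), or [None] for (0 : 1). *)
Definition hcoord0 (T : option F) : F := if T is Some _ then 1 else 0.
Definition hcoord1 (T : option F) : F := if T is Some t then t else 1.

Lemma hcoord_neq0 T : hcoord0 T != 0 \/ hcoord1 T != 0.
Proof. by case: T => [t|]; [left|right]; rewrite oner_eq0. Qed.

Lemma hcoord_cross T U : T != U ->
  hcoord1 T * hcoord0 U - hcoord0 T * hcoord1 U != 0.
Proof.
case: T U => [t|] [u|] //= ntu;
  rewrite ?(mul0r, mulr0, mulr1, mul1r, subr0, sub0r, oppr_eq0, oner_eq0) //.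
by rewrite subr_eq0; apply: contraNneq ntu => ->.
Qed.

Definition hmonom (d i : nat) (T : option F) : F :=
  hcoord0 T ^+ (d - i) * hcoord1 T ^+ i.

(** Here [p] is the form dehomogenised at [hcoord0 = 1]. The point [None] is a zero only if the top
    coefficient vanishes; then [p] has degree below [d], which leaves room for one affine root
    fewer. *)
Lemma card_form_neq0 (d : nat) (c : 'I_d.+1 -> F) (i0 : 'I_d.+1) : c i0 != 0 ->
  (#|F|.+1 - d <= #|[set T | (\sum_i c i * hmonom d i T != 0)%R]|)%N.
Proof.
move=> ci0; set Z := [set T | _].
suff: (#|~: Z| <= d)%N.
  by rewrite leq_subLR -card_option -(cardsC Z) addnC leq_add2r.
pose p := \poly_(i < d.+1) c (inord i); pose R := [set t | root p t].
have pcoef (i : 'I_d.+1) : p`_i = c i by rewrite coef_poly ltn_ord inord_val.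
have p0 : p != 0 by apply: contraNneq ci0 => p0; rewrite -pcoef p0 coef0.
have ltR : (#|R| < size p)%N.
  rewrite cardE; apply: max_poly_roots => //; last exact: enum_uniq.
  by apply/allP => t; rewrite mem_enum inE.
have fS t : \sum_i c i * hmonom d i (Some t) = p.[t].
  rewrite horner_poly; apply: eq_bigr => i _.
  by rewrite /hmonom expr1n mul1r inord_val.
have fN : \sum_i c i * hmonom d i None = c ord_max.
  rewrite big_ord_recr big1 /= => [|i _]; rewrite /hmonom /=.
    by rewrite subnn expr1n !mulr1 add0r.
  by rewrite expr0n subn_eq0 leqNgt ltn_ord /= mul0r mulr0.
have ZS : ~: Z \subset (if c ord_max == 0 then [set None] else set0) :|: Some @: R.
  apply/subsetP => -[t|]; rewrite !inE negbK.
    by rewrite fS => rt; apply/orP; right; apply/imset_f; rewrite inE.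
  by rewrite fN => /eqP->; rewrite eqxx inE.
apply: (leq_trans (subset_leq_card ZS)).
apply: (leq_trans (leq_card_setU _ _)); rewrite card_imset; last by move=> ? ? [].
have szp : (size p <= d.+1)%N by apply: size_poly.
case: eqP => [cd0|_]; rewrite ?cards1 ?cards0; last first.
  by rewrite add0n -ltnS (leq_trans ltR szp).
rewrite add1n; apply: leq_trans ltR _.
apply/leq_sizeP => j; rewrite leq_eqVlt => /predU1P[<-|ltdj].
  by rewrite (pcoef ord_max).
exact/nth_default/(leq_trans szp).
Qed.

End FiniteField.

(** * Weights and dimensions of evaluation codes on the Hirzebruch surface *)

Section Hirzebruch.

Set Implicit Arguments.
Unset Strict Implicit.

Variables (F : finFieldType) (e n : nat) (pt : 'I_n -> option F * option F).
Hypothesis pt_bij : bijective pt.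

Definition evalw (f : option F * option F -> F) : 'rV[F]_n := \row_i f (pt i).

(* The subtractions are truncated: this is the intended monomial only when
   [j <= A] and [i + e * j <= B]. *)
Definition smonom (A B j i : nat) : 'rV[F]_n :=
  evalw (fun P => hmonom (B - e * j) i P.1 * hmonom A j P.2).

(* With [e * A <= B], the condition [i <= B - e * j] is [i + e * j <= B]. *)
Definition expo (A B : nat) : finType := {j : 'I_A.+1 & 'I_(B - e * j).+1}.

Definition sections (A B : nat) : {vspace 'rV[F]_n} :=
  (\sum_(k : expo A B)
     <[smonom A B (tag k) (tagged k)]>)%VS.

Lemma weight_evalw f : hamming_weight (evalw f) = #|[set P | f P != 0]|.
Proof.
rewrite /hamming_weight -[RHS](@on_card_preimset _ _ pt).
  by apply: eq_card => i; rewrite !inE mxE.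
exact: onW_bij.
Qed.

(** Collected by [j], the section restricts to each fibre as a form of degree [A], whose
    coefficients [C T j] are forms of degree [B - e * j] in [T]. The root bound is applied to
    [C _ j0], then on each fibre where [C T j0] is nonzero. *)
Lemma weight_comb A B (c : expo A B -> F) k0 :
  c k0 != 0 ->
  ((#|F|.+1 - B) * (#|F|.+1 - A) <=
   hamming_weight (\sum_k c k *: smonom A B (tag k) (tagged k)))%N.
Proof.
move=> ck0.
pose C (T : option F) (j : 'I_A.+1) :=
  \sum_(i < (B - e * j).+1) c (Tagged _ i) * hmonom (B - e * j) i T.
have -> : \sum_k c k *: smonom A B (tag k) (tagged k) =
          evalw (fun P => \sum_j C P.1 j * hmonom A j P.2).
  apply/rowP => i; rewrite summxE mxE.
  under [RHS]eq_bigr => j _ do rewrite mulr_suml.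
  rewrite sig_big_dep /=; apply: eq_bigr => -[j l] _.
  by rewrite !mxE mulrA.
rewrite weight_evalw; case: k0 ck0 => j0 i0 /= ck0.
pose Good := [set T | C T j0 != 0].
have leG : (#|F|.+1 - B <= #|Good|)%N.
  apply: leq_trans (card_form_neq0 (c := fun i => c (Tagged _ i)) ck0).
  by apply: leq_sub2l; apply: leq_subr.
apply: (@leq_trans (\sum_(T in Good) (#|F|.+1 - A))%N).
  by rewrite sum_nat_const leq_mul2r leG orbT.
apply: (@leq_trans (\sum_(T in Good)
          #|[set X | (\sum_j C T j * hmonom A j X != 0)%R]|)%N).
  apply: leq_sum => T; rewrite inE => CT; exact: card_form_neq0 CT.
under eq_bigr => T _ do rewrite -sum1_card.
rewrite pair_big_dep /= sum1_card; apply/subset_leq_card/subsetP => -[T X].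
by rewrite -topredE /= !inE => /andP[].
Qed.

Lemma sectionsP A B u : u \in sections A B ->
  exists c : expo A B -> F, u = \sum_k c k *: smonom A B (tag k) (tagged k).
Proof.
case/memv_sumP => v vP ->; exists (fun k => sval (sig_eqW (vlineP _ _ (vP k isT)))).
by apply: eq_bigr => k _; case: sig_eqW.
Qed.

Lemma weight_sections A B u : u \in sections A B -> u != 0 ->
  ((#|F|.+1 - B) * (#|F|.+1 - A) <= hamming_weight u)%N.
Proof.
case/sectionsP=> c -> u0.
have [/existsP[k0]|] := boolP [exists k, c k != 0]; first exact: weight_comb.
rewrite negb_exists => /forallP c0; case/eqP: u0; apply: big1 => k _.
by have := c0 k; rewrite negbK => /eqP->; rewrite scale0r.
Qed.

Lemma weight0 : hamming_weight (0 : 'rV[F]_n) = 0%N.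
Proof.
by apply/eqP; rewrite cards_eq0; apply/eqP/setP => i; rewrite !inE mxE eqxx.
Qed.

(** The bounds on [A] and [B] make the weight bound positive, so the monomials evaluate to linearly
    independent vectors. *)
Lemma dim_sections A B : (A <= #|F|)%N -> (B <= #|F|)%N ->
  \dim (sections A B) = (\sum_(j < A.+1) (B - e * j).+1)%N.
Proof.
move=> leA leB.
have indep (c : expo A B -> F) :
    \sum_k c k *: smonom A B (tag k) (tagged k) = 0 -> forall k, c k = 0.
  move=> s0 k; apply/eqP; apply: contraT => /weight_comb.
  rewrite s0 weight0 leqn0 muln_eq0 !subn_eq0; lia.
have dx : directv (sections A B).
  apply/directv_sum_independent => us Us us0 k _.
  have cP k' := vlineP _ _ (Us k' isT).
  have us_c k' : us k' = sval (sig_eqW (cP k')) *: smonom A B (tag k') (tagged k').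
    by case: sig_eqW.
  rewrite us_c; rewrite (eq_bigr _ (fun k' _ => us_c k')) in us0.
  by rewrite (indep _ us0) scale0r.
rewrite (directvP dx) /=.
rewrite (eq_bigr (fun _ => 1%N)) => [|k _]; last first.
  rewrite dim_vline; apply/eqP; rewrite eqb1; apply/eqP => m0.
  suff /(_ k) /eqP : forall k', (k' == k)%:R = 0 :> F by rewrite eqxx oner_eq0.
  apply: indep; rewrite (bigD1 k) //= m0 scaler0 add0r big1 // => k' /negbTE->.
  by rewrite scale0r.
rewrite -(sig_big_dep (fun _ => true) (fun _ _ => true) (fun _ _ => 1%N)) /=.
by apply: eq_bigr => j _; rewrite sum1_card card_ord.
Qed.

Lemma smonom_sections A B j i : (j <= A)%N -> (i + e * j <= B)%N ->
  smonom A B j i \in sections A B.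
Proof.
move=> leA leB.
have ltj : (j < A.+1)%N by [].
have lti : (i < (B - e * Ordinal ltj).+1)%N by rewrite /= ltnS; lia.
rewrite memvE; pose Iexp (k : 'I_A.+1) := 'I_(B - e * k).+1.
exact: (sumv_sup (Tagged Iexp (Ordinal lti))).
Qed.

Lemma sections_sub A B (U : {vspace 'rV[F]_n}) : (e * A <= B)%N ->
  (forall j i, (j <= A)%N -> (i + e * j <= B)%N -> smonom A B j i \in U) ->
  (sections A B <= U)%VS.
Proof.
move=> leAB mU; apply/subv_sumP => -[j i] _ /=; rewrite -memvE; apply: mU.
  by rewrite -ltnS.
have := ltn_ord i; have := ltn_ord j; rewrite /= !ltnS => lej lei.
have : (e * j <= e * A)%N by rewrite leq_mul2l lej orbT.
lia.
Qed.

(** * Products of sections and sections without rational zeros *)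

Definition pmul (u v : 'rV[F]_n) : 'rV[F]_n := \row_i (u 0 i * v 0 i).

Lemma pmulE u v i : pmul u v 0 i = u 0 i * v 0 i.
Proof. by rewrite mxE. Qed.

Lemma pmulC u v : pmul u v = pmul v u.
Proof. by apply/rowP => i; rewrite !pmulE mulrC. Qed.

Definition pmulr (v : 'rV[F]_n) : 'End('rV[F]_n) := linfun (mulmxr (diag_mx v)).

Lemma pmulrE v u : pmulr v u = pmul u v.
Proof.
by rewrite lfunE /= mul_mx_diag; apply/rowP => i; rewrite !mxE.
Qed.

Lemma pmul_sections A B A' B' u v : (e * A <= B)%N -> (e * A' <= B')%N ->
  u \in sections A B -> v \in sections A' B' ->
  pmul u v \in sections (A + A') (B + B').
Proof.
move=> leAB leAB' uW vW.
(* Taking preimages under multiplication by a fixed vector lets [sections_sub] reduce first [u],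
   then [v], to monomials. *)
suff /subvP/(_ u uW) : (sections A B <= pmulr v @^-1: sections (A + A') (B + B'))%VS.
  by rewrite -memv_preim pmulrE.
apply: sections_sub => // j i leA leB; rewrite -memv_preim pmulrE pmulC -pmulrE.
rewrite memv_preim; move: v vW; apply/subvP.
apply: sections_sub => // j' i' leA' leB'; rewrite -memv_preim pmulrE.
have -> : pmul (smonom A' B' j' i') (smonom A B j i) =
          smonom (A + A') (B + B') (j + j') (i + i').
  apply/rowP => l; rewrite pmulE !mxE /hmonom.
  have -> : (B + B' - e * (j + j') - (i + i') =
             (B - e * j - i) + (B' - e * j' - i'))%N by lia.
  have -> : (A + A' - (j + j') = (A - j) + (A' - j'))%N by lia.
  by rewrite !exprD; ring.
by apply: smonom_sections; lia.
Qed.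

Lemma const_sections : const_mx 1 \in sections 0 0.
Proof.
have <- : smonom 0 0 0 0 = const_mx 1; last by apply: smonom_sections; lia.
by apply/rowP => i; rewrite !mxE /hmonom !expr0 !mulr1.
Qed.

Definition ppow (u : 'rV[F]_n) d : 'rV[F]_n := \row_i u 0 i ^+ d.

Lemma ppow_sections A B u d : (e * A <= B)%N -> u \in sections A B ->
  ppow u d \in sections (d * A) (d * B).
Proof.
move=> leAB uW; elim: d => [|d IH].
  have -> : ppow u 0 = const_mx 1 by apply/rowP => i; rewrite !mxE.
  exact: const_sections.
have -> : ppow u d.+1 = pmul u (ppow u d).
  by apply/rowP => i; rewrite pmulE !mxE exprS.
by rewrite !mulSn; apply: pmul_sections => //; nia.
Qed.

(** The anisotropic binary form is evaluated at [u] and [v]. Keeping these general serves both for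
    forms in [T] alone and for the form in [X0 N] and [X1]. *)
Lemma aniso_sections A B u v d : (e * A <= B)%N ->
  u \in sections A B -> v \in sections A B ->
  (forall i, u 0 i != 0 \/ v 0 i != 0) -> d <> 1%N ->
  exists2 g, g \in sections (d * A) (d * B) & forall i, g 0 i != 0.
Proof.
move=> leAB uW vW uv; case: d => [|[|d]] // _.
  rewrite !mul0n; exists (const_mx 1) => [|i]; first exact: const_sections.
  by rewrite mxE oner_eq0.
have [c cP] := @exists_missed_value F d.+2 isT.
exists (ppow v d.+2 - pmul u (ppow v d.+1) - c *: ppow u d.+2).
  rewrite !rpredB ?rpredZ ?ppow_sections //.
  by rewrite mulSn [X in sections _ X]mulSn pmul_sections ?ppow_sections //; nia.
move=> i; rewrite !mxE.
(* Where [u] vanishes only the power of [v] survives; elsewhere, dividing by [u ^+ d.+2] would give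
   the missed value [c] at [v / u]. *)
have [u0|u0] := eqVneq (u 0 i) 0.
  have {uv}: v 0 i != 0 by have := uv i; rewrite u0 eqxx; case.
  by rewrite u0 !expr0n /= mul0r mulr0 !subr0 => v0; rewrite expf_neq0.
have := cP (v 0 i / u 0 i); apply: contraNneq => E.
have : u 0 i ^+ d.+2 * ((v 0 i / u 0 i) ^+ d.+2 - (v 0 i / u 0 i) ^+ d.+1 - c) = 0.
  rewrite -[RHS]E !mulrBr !expr_div_n; congr (_ - _ - _).
  - by rewrite mulrCA mulfV ?mulr1 // expf_neq0.
  - by rewrite mulrCA [_ ^+ d.+2]exprS mulfK ?expf_neq0 // mulrC.
  - by rewrite mulrC.
by move/eqP; rewrite mulf_eq0 expf_eq0 /= (negbTE u0) /= => /eqP->.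
Qed.

Lemma exists_nowhere_zero da db : (2 <= e)%N -> (e * da <= db)%N ->
  da <> 1%N -> (db - e * da)%N <> 1%N ->
  exists2 g, g \in sections da db & forall i, g 0 i != 0.
Proof.
move=> he led da1 db1.
pose t0 := smonom 0 1 0 0; pose t1 := smonom 0 1 0 1.
have t0E i : t0 0 i = hcoord0 (pt i).1.
  by rewrite mxE /hmonom muln0 !expr0 expr1 !mulr1.
have t1E i : t1 0 i = hcoord1 (pt i).1.
  by rewrite mxE /hmonom muln0 !expr0 expr1 !mulr1 mul1r.
have t0W : t0 \in sections 0 1 by apply: smonom_sections; lia.
have t1W : t1 \in sections 0 1 by apply: smonom_sections; lia.
have tn0 i : t0 0 i != 0 \/ t1 0 i != 0 by rewrite t0E t1E; apply: hcoord_neq0.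
have e01 : (e * 0 <= 1)%N by lia.
have [N NW N0] := @aniso_sections _ _ _ _ e e01 t0W t1W tn0 ltac:(lia).
have [L LW L0] := @aniso_sections _ _ _ _ (db - e * da) e01 t0W t1W tn0 db1.
rewrite !muln0 !muln1 in NW LW.
pose x0 := smonom 1 0 0 0; pose x1 := smonom 1 e 1 0.
have x0E i : x0 0 i = hcoord0 (pt i).2.
  by rewrite mxE /hmonom muln0 !expr0 expr1 !mulr1 mul1r.
have x1E i : x1 0 i = hcoord1 (pt i).2.
  by rewrite mxE /hmonom muln1 subnn !expr0 expr1 !mul1r.
have e11 : (e * 1 <= e)%N by rewrite muln1.
(* The degree (1, 0) of [x0] violates [e * A <= B], so [pmul_sections] does not apply and the
   product is checked on monomials. *)
have uW : pmul N x0 \in sections 1 e.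
  suff /subvP/(_ N NW) : (sections 0 e <= pmulr x0 @^-1: sections 1 e)%VS.
    by rewrite -memv_preim pmulrE.
  apply: sections_sub => [|j i]; first by rewrite muln0.
  rewrite leqn0 => /eqP-> lei; rewrite -memv_preim pmulrE.
  have -> : pmul (smonom 0 e 0 i) x0 = smonom 1 e 0 i; last exact: smonom_sections.
  by apply/rowP => l; rewrite pmulE x0E !mxE /hmonom !expr0 expr1 !mulr1.
have vW : x1 \in sections 1 e by apply: smonom_sections => //; lia.
have uv i : pmul N x0 0 i != 0 \/ x1 0 i != 0.
  by rewrite pmulE x0E x1E mulf_eq0 (negbTE (N0 i)); apply: hcoord_neq0.
have [G GW G0] := aniso_sections e11 uW vW uv da1.
rewrite muln1 in GW; exists (pmul L G).
  have -> : db = (db - e * da + da * e)%N by lia.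
  by rewrite -[da in sections da _]add0n; apply: pmul_sections => //; lia.
by move=> i; rewrite pmulE mulf_neq0.
Qed.

(** * Separation of points and dual distance *)

(** Each point of [s] costs one factor: of degree (0, 1) if its fibre differs from that of [P0], of
    degree (1, e) otherwise. Both hypotheses on [A] and [B] survive either reduction. *)
Lemma separating_section A B (P0 : 'I_n) (s : seq 'I_n) :
  (size s <= A)%N -> (size s + e * A <= B)%N -> P0 \notin s ->
  exists2 f, f \in sections A B
    & f 0 P0 != 0 /\ forall P, P \in s -> f 0 P = 0.
Proof.
elim: s A B => [|P s IH] A B /= leA leB.
  move=> _; have lAB : (e * A <= B)%N by lia.
  (* Both components of [P0] have a coordinate equal to 1; pure powers of these give a monomial with
     value 1 at [P0]. *)
  pose j := if (pt P0).2 is Some _ then 0%N else A.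
  pose i := if (pt P0).1 is Some _ then 0%N else (B - e * j)%N.
  have lej : (j <= A)%N by rewrite /j; case: (pt P0).2.
  have lejB : (e * j <= B)%N by apply: leq_trans lAB; rewrite leq_mul2l lej orbT.
  have lei : (i + e * j <= B)%N by rewrite /i; case: (pt P0).1 => [_|]; lia.
  exists (smonom A B j i); first exact: smonom_sections.
  split=> //; rewrite mxE /hmonom /i /j.
  by case: (pt P0) => [[t|] [x|]] /=;
     rewrite ?subnn ?expr0 ?expr1n ?mulr1 ?mul1r oner_eq0.
rewrite inE negb_or => /andP[nP0 P0s].
have [T0|nT0] := eqVneq (pt P0).1 (pt P).1; last first.
  have [|||f fW [fP0 fs]] := IH A B.-1; rewrite ?P0s //; try lia.
  pose l := hcoord1 (pt P).1 *: smonom 0 1 0 0 - hcoord0 (pt P).1 *: smonom 0 1 0 1.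
  have lE Q : l 0 Q = hcoord1 (pt P).1 * hcoord0 (pt Q).1
                      - hcoord0 (pt P).1 * hcoord1 (pt Q).1.
    by rewrite !mxE /hmonom muln0 !expr0 !expr1 !mulr1 mul1r.
  have lW : l \in sections 0 1.
    by rewrite rpredB ?rpredZ ?smonom_sections //; lia.
  exists (pmul f l).
    have -> : sections A B = sections (A + 0) (B.-1 + 1) by congr sections; lia.
    by apply: pmul_sections => //; lia.
  split; first by rewrite pmulE mulf_neq0 // lE hcoord_cross // eq_sym.
  move=> Q; rewrite inE pmulE => /predU1P[->|/fs->]; last by rewrite mul0r.
  by rewrite lE [X in _ - X]mulrC subrr mulr0.
have nX : (pt P).2 != (pt P0).2.
  apply: contraNneq nP0 => X0; apply/eqP/(bij_inj pt_bij).
  by rewrite [LHS]surjective_pairing [RHS]surjective_pairing T0 X0.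
have [|||f fW [fP0 fs]] := IH A.-1 (B - e)%N; rewrite ?P0s //; try nia.
(* This [k] makes the [T]-part of the first monomial of [l] equal to 1 on the common fibre, where
   [l] is then a linear form vanishing only at [P]. *)
pose k := if (pt P).1 is Some _ then 0%N else e.
have lek : (k <= e)%N by rewrite /k; case: (pt P).1.
have kT : hmonom e k (pt P).1 = 1.
  by rewrite /hmonom /k; case: (pt P).1 => [t|] /=; rewrite ?subnn ?expr0 ?expr1n mulr1.
pose l := hcoord1 (pt P).2 *: smonom 1 e 0 k - hcoord0 (pt P).2 *: smonom 1 e 1 0.
have lE Q : (pt Q).1 = (pt P).1 -> l 0 Q = hcoord1 (pt P).2 * hcoord0 (pt Q).2
                    - hcoord0 (pt P).2 * hcoord1 (pt Q).2.
  move=> TQ; rewrite !mxE TQ muln0 muln1 subnn subn0 kT.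
  by rewrite /hmonom !expr0 !expr1 !mulr1 !mul1r.
have lW : l \in sections 1 e.
  by rewrite rpredB ?rpredZ ?smonom_sections //; lia.
exists (pmul f l).
  have -> : sections A B = sections (A.-1 + 1) ((B - e) + e) by congr sections; nia.
  by apply: pmul_sections => //; nia.
split; first by rewrite pmulE mulf_neq0 // lE // hcoord_cross.
move=> Q; rewrite inE pmulE => /predU1P[->|/fs->]; last by rewrite mul0r.
by rewrite lE // [X in _ - X]mulrC subrr mulr0.
Qed.

(** If the support of [x] had at most [m.+1] points, a section separating one of them from the
    others, multiplied by [g], would pair with [x] in a single nonzero term. *)
Lemma weight_dual_sections A B m (g : 'rV[F]_n) x :
  (m <= A)%N -> (m + e * A <= B)%N -> (forall i, g 0 i != 0) ->
  x \in dual_code (pmulr g @: sections A B)%VS -> x != 0 ->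
  (m.+2 <= hamming_weight x)%N.
Proof.
move=> leA leB g0; rewrite inE => /forall_inP xC x0; rewrite ltnNge.
apply: contra x0 => lex; set S := [set i | x 0 i != 0] in lex.
apply: contraT => /rV0Pn[P0 xP0].
have P0S : P0 \in S by rewrite inE.
have szs : (size (enum (S :\ P0)) <= m)%N.
  by rewrite -cardE; move: lex; rewrite /hamming_weight (cardsD1 P0) P0S.
have [|||f fW [fP0 fs]] := @separating_section A B P0 (enum (S :\ P0)) _ _ _.
- exact: leq_trans leA.
- by apply: leq_trans leB; rewrite leq_add2r.
- by rewrite mem_enum !inE eqxx.
have /xC/eqP : pmul f g \in (pmulr g @: sections A B)%VS.
  by rewrite -pmulrE memv_img.
rewrite (bigD1 P0) //= big1 => [|i niP0]; last first.
  rewrite pmulE; have [->|xi] := eqVneq (x 0 i) 0; first by rewrite mul0r.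
  by rewrite fs ?mul0r ?mulr0 // mem_enum !inE niP0.
by move/eqP; rewrite addr0 pmulE !mulf_eq0 (negbTE xP0) (negbTE fP0) (negbTE (g0 _)).
Qed.

Lemma lker_pmulr (g : 'rV[F]_n) : (forall i, g 0 i != 0) -> lker (pmulr g) = 0%VS.
Proof.
move=> g0; apply/eqP/lker0P => u v; rewrite !pmulrE => /rowP E.
by apply/rowP => i; apply: (mulIf (g0 i)); have := E i; rewrite !pmulE.
Qed.

End Hirzebruch.

(** * Parameters of the quantum code *)

Lemma lattice_points_rat (e A B : nat) : (e * A <= B)%N ->
  ((\sum_(j < A.+1) (B - e * j).+1)%N)%:R =
  (A%:R + 1) * (B%:R + 1 - e%:R * A%:R / 2%:R) :> rat.
Proof.
elim: A => [|A IH] leAB; first by rewrite big_ord1 muln0 subn0 -natr1; ring.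
rewrite big_ord_recr /= natrD IH; last by nia.
by rewrite -!natr1 natrB // natrM -natr1; field.
Qed.

Lemma le_min_weight (F : finFieldType) (n : nat) (E : {set 'rV[F]_n}) (m : nat) :
  (forall x, x \in E -> (m <= hamming_weight x)%N) ->
  ((m%:Z)%:E <= min_weight E)%E.
Proof.
move=> mE; apply: le_bigmin => [|x /mE mx]; first exact: leey.
by rewrite lee_fin lez_nat.
Qed.

Theorem theorem6p2 (q : nat) (F : finFieldType) (hq : #|F| = q)
  (e : nat) (he : (2 <= e)%N)
  (a b : nat) (ha : (0 < a)%N) (hb : (0 < b)%N)
  (da db : nat) (hda : da <> 1%N) (hdb : db <> 1%N)
  (haq : (a + da <= q - 1)%N) (hbq : (b + db <= q - 1)%N)
  (hab : 0 <= b%:Z - e%:Z * a%:Z)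
  (hd0 : 0 <= db%:Z - e%:Z * da%:Z)
  (hdq : db%:Z - e%:Z * da%:Z <= q%:Z - 1)
  (hd1 : db%:Z - e%:Z * da%:Z <> 1) :
  exists Q : css_code F ((q + 1) ^ 2)%N,
    (css_dim Q)%:R =
      (a%:R + da%:R + 1) * (b%:R + db%:R + 1 - e%:R * (a%:R + da%:R) / 2%:R)
      - (a%:R + 1) * (b%:R + 1 - e%:R * a%:R / 2%:R) :> rat
    /\ ((Num.min a%:Z (b%:Z - e%:Z * a%:Z) + 2)%:E <= css_dist Q)%E.
Proof.
have leab : (e * a <= b)%N by lia.
have led : (e * da <= db)%N by lia.
have [pt pt_bij] : exists pt : 'I_((q + 1) ^ 2) -> option F * option F, bijective pt.
  have En : #|{: option F * option F}| = ((q + 1) ^ 2)%N.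
    by rewrite card_prod card_option hq addn1.
  exists (fun i => enum_val (cast_ord (esym En) i)).
  exists (fun P => cast_ord En (enum_rank P)) => [i|P].
    by rewrite enum_valK cast_ordKV.
  by rewrite cast_ordK enum_rankK.
have [g gW g0] := @exists_nowhere_zero F e _ pt da db he led hda ltac:(lia).
pose W := sections e pt.
have nested : (pmulr g @: W a b <= W (a + da)%N (b + db)%N)%VS.
  apply/subvP => _ /memv_imgP[f fW ->]; rewrite pmulrE.
  exact: pmul_sections.
exists (CSSCode nested); split.
  rewrite /css_dim /= natrB; last exact: dimvS nested.
  rewrite limg_dim_eq; last by rewrite lker_pmulr ?capv0.
  rewrite !dim_sections //; try by rewrite hq; lia.
  by rewrite !lattice_points_rat ?natrD //; nia.
have -> : Num.min a%:Z (b%:Z - e%:Z * a%:Z) + 2 = (minn a (b - e * a)).+2%:Z.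
  by lia.
rewrite /css_dist le_min !le_min_weight //= => x.
  case/setDP=> xD xnD; apply: (weight_dual_sections pt_bij _ _ g0 xD).
  - exact: geq_minl.
  - have := geq_minr a (b - e * a); move: (minn _ _); lia.
  - apply: contraNneq xnD => ->; rewrite inE; apply/forall_inP => c _.
    by rewrite big1 // => i _; rewrite mxE mul0r.
rewrite inE => /andP[xW xnW].
have x0 : x != 0 by apply: contraNneq xnW => ->; apply: mem0v.
(* Since [2 * (a + da) <= b + db <= q - 1], the two factors are at least 2 and (q + 3) / 2, so the
   weight is at least [q + 3], which exceeds [a + 2]. *)
have := weight_sections pt_bij xW x0; rewrite hq; nia.
Qed.
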